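(* Let $\Phi=\{\Phi_j\}_{j=1}^J$ be a self-affine system on $\mathbb{R}^d$ with attractor $F$ and convex hull $C=[F]$, $\dim C=d$, satisfying the tileset condition and the nontriviality condition. Let $C_k=\Phi^k(C)$ for $k\ge0$, let $T_k=\overline{C_{k-1}\setminus C_k}$ for $k\ge1$ be the tilesets, and let $\{G_q\}_{q=1}^Q$ be the generators. Then for every $k\ge1$, $$T_k=\overline{\bigsqcup\nolimits_{q=1}^Q\Phi^{k-1}(G_q)},$$ where $\bigsqcup$ indicates that the sets $\Phi^{k-1}(G_q)$, $q=1,\dots,Q$, are pairwise disjoint.
   Context: A self-affine system on $\mathbb{R}^d$ is a finite family $\Phi=\{\Phi_j\}_{j=1}^J$, $2\le J<\infty$, of invertible affine maps $\Phi_j:\mathbb{R}^d\to\mathbb{R}^d$, each of which is a contraction for the Euclidean norm. Its action on sets is $\Phi(A):=\bigcup_{j=1}^J\Phi_j(A)$ for $A\subseteq\mathbb{R}^d$, and $\Phi^k$ is the $k$-fold iterate of this set map ($\Phi^0$ is the identity). The attractor $F$ is the unique nonempty compact set with $F=\Phi(F)$. $C:=[F]$ is the convex hull of $F$; $\dim C=d$ means the smallest affine subspace containing $C$ is $\mathbb{R}^d$. Put $C_0:=C$ and $C_k:=\Phi^k(C)=\Phi(C_{k-1})$ for $k\ge1$. Tileset condition: $\operatorname{int}\Phi_j(C)\cap\operatorname{int}\Phi_\ell(C)=\emptyset$ for all $j\ne\ell$. Nontriviality condition: $\operatorname{int}C\not\subseteq\Phi(C)$. The generators $G_1,G_2,\dots,G_Q$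 are the connected components of the open set $\operatorname{int}(C\setminus\Phi(C))$; their number $Q$ is finite or countably infinite ($Q=\infty$ is not excluded). Interior and closure are taken in $\mathbb{R}^d$. *)

(* Defs.v *)
From mathcomp Require Import all_boot all_order all_algebra.
From mathcomp Require Import all_classical all_reals all_analysis.

Set Implicit Arguments.
Unset Strict Implicit.
Unset Printing Implicit Defensive.

Import Order.TTheory GRing.Theory Num.Theory.
Import numFieldNormedType.Exports.

Local Open Scope classical_set_scope.
Local Open Scope ring_scope.

(* The library norm on 'rV[R]_d is the sup norm, hence this separate
   definition; both norms induce the topology of 'rV[R]_d. *)
Definition euclid_norm (R : realType) (d : nat) (x : 'rV[R]_d) : R :=
  Num.sqrt (\sum_(i < d) x ord0 i ^+ 2).

Definition affine_map (R : realType) (d : nat) (f : 'rV[R]_d -> 'rV[R]_d) :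
    Prop :=
  exists (L : {linear 'rV[R]_d -> 'rV[R]_d}) (b : 'rV[R]_d),
    forall x, f x = L x + b.

Definition euclid_contraction (R : realType) (d : nat)
    (f : 'rV[R]_d -> 'rV[R]_d) : Prop :=
  exists c : R, [/\ 0 <= c, c < 1 &
    forall x y, euclid_norm (f x - f y) <= c * euclid_norm (x - y)].

Definition self_affine_system (R : realType) (d J : nat)
    (Phi : 'I_J -> 'rV[R]_d -> 'rV[R]_d) : Prop :=
  (2 <= J)%N /\
  forall j, [/\ affine_map (Phi j), bijective (Phi j) &
                euclid_contraction (Phi j)].

Definition ifs_map (R : realType) (d J : nat)
    (Phi : 'I_J -> 'rV[R]_d -> 'rV[R]_d) (A : set 'rV[R]_d) : set 'rV[R]_d :=
  \bigcup_(j : 'I_J) (Phi j @` A).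

Definition ifs_iter (R : realType) (d J : nat)
    (Phi : 'I_J -> 'rV[R]_d -> 'rV[R]_d) (k : nat) :
    set 'rV[R]_d -> set 'rV[R]_d :=
  iter k (ifs_map Phi).

(* Uniqueness of such an F is Hutchinson's theorem, not part of the
   definition. *)
Definition is_attractor (R : realType) (d J : nat)
    (Phi : 'I_J -> 'rV[R]_d -> 'rV[R]_d) (F : set 'rV[R]_d) : Prop :=
  [/\ F !=set0, compact F & F = ifs_map Phi F].

Definition convex_hull (R : realType) (d : nat) (A : set 'rV[R]_d) :
    set 'rV[R]_d :=
  smallest (@convex_set R 'rV[R]_d) A.

Definition affine_subspace (R : realType) (d : nat) (A : set 'rV[R]_d) : Prop :=
  exists (v : 'rV[R]_d) (W : {vspace 'rV[R]_d}), A = [set x | x - v \in W].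

Definition full_dim (R : realType) (d : nat) (A : set 'rV[R]_d) : Prop :=
  smallest (@affine_subspace R d) A = setT.

Definition tileset_condition (R : realType) (d J : nat)
    (Phi : 'I_J -> 'rV[R]_d -> 'rV[R]_d) (C : set 'rV[R]_d) : Prop :=
  forall j l : 'I_J, j != l ->
    interior (Phi j @` C) `&` interior (Phi l @` C) = set0.

Definition nontriviality_condition (R : realType) (d J : nat)
    (Phi : 'I_J -> 'rV[R]_d -> 'rV[R]_d) (C : set 'rV[R]_d) : Prop :=
  ~ (interior C `<=` ifs_map Phi C).

(* Meaningful for k >= 1 only. *)
Definition tileset (R : realType) (d J : nat)
    (Phi : 'I_J -> 'rV[R]_d -> 'rV[R]_d) (C : set 'rV[R]_d) (k : nat) :
    set 'rV[R]_d :=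
  closure (ifs_iter Phi k.-1 C `\` ifs_iter Phi k C).

(* The family (G_q), indexed by the components themselves instead of by a
   chosen enumeration q = 1, 2, ..., Q. *)
Definition generators (R : realType) (d J : nat)
    (Phi : 'I_J -> 'rV[R]_d -> 'rV[R]_d) (C : set 'rV[R]_d) :
    set (set 'rV[R]_d) :=
  let U := interior (C `\` ifs_map Phi C) in connected_component U @` U.

(* Main.v *)
Require Import Defs.
From HB Require Import structures.
From mathcomp Require Import all_boot all_order all_algebra.
From mathcomp Require Import all_classical all_reals all_analysis.

(** Write [Phi^k] for the [k]-fold iterate of the set map [ifs_map Phi], [C] for
    the convex hull of the attractor [F] and [U] for the interior of
    [C \ Phi(C)], so that the generators are the components of [U] and
    [Phi^k] of their union is [Phi^k(U)]. With [k + 1] for [k], the theorem says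
    that [Phi^k(U)] and [C_k \ C_(k+1) = Phi^k(C) \ Phi^k(Phi(C))] have the same
    closure.

    Three properties of [C] carry the proof. The affine maps [Phi_j] send [C]
    into itself, because they send [F] into [F]. Since [F] is compact, so is
    [C]: by Caratheodory's theorem [C] is the image of the compact space of
    convex combinations of [d + 1] points of [F] ([caratheodory],
    [convex_hull_compact]); hence [Phi(C)] is closed. Finally the nontriviality
    condition makes the interior of [C] nonempty, so the convex set [C] lies in
    the closure of its interior ([convex_closure_interior]).

    The last property strengthens the tileset condition: an image by [Phi_j] of
    an interior point of [C] is never an image by [Phi_l] of any point of [C],
    boundary points included, when [j <> l] ([tile_address]). Peeling off one
    map at a time, [Phi^k] therefore preserves the disjointness of [A] and [B]
    as soon as [A] is inside the interior of [C] and [B] inside [C]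
    ([ifs_iter_disjoint]). For two generators this is their disjointness at
    level [k]; for [U] and [Phi(C)] it says that [Phi^k(U)] avoids [C_(k+1)],
    which gives one inclusion between the closures.

    For the other inclusion, [C_k \ C_(k+1)] is contained in
    [Phi^k(C \ Phi(C))] by pure set theory, [C \ Phi(C)] is contained in the
    closure of [U] because [Phi(C)] is closed and [C] lies in the closure of its
    interior, and continuous maps send closures into closures. *)

Set Implicit Arguments.
Unset Strict Implicit.
Unset Printing Implicit Defensive.

Import Order.TTheory GRing.Theory Num.Theory.
Import numFieldNormedType.Exports.

Local Open Scope classical_set_scope.
Local Open Scope ring_scope.

(** * Convex combinations and compactness of convex hulls *)

Definition simplex (R : realType) (n : nat) : set 'rV[R]_n :=
  [set a | (forall i, 0 <= a ord0 i) /\ \sum_(i < n) a ord0 i = 1].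

Arguments simplex : clear implicits.

(** Uncurried, so that the combinations of [n] points of a set are the image of a
    product of two sets. *)
Definition combination (R : realType) (d n : nat)
    (ap : 'rV[R]_n * ('I_n -> 'rV[R]_d)) : 'rV[R]_d :=
  \sum_(i < n) ap.1 ord0 i *: ap.2 i.

Definition combinations (R : realType) (d n : nat) (A : set 'rV[R]_d) :
    set 'rV[R]_d :=
  @combination R d n @` (simplex R n `*` [set p | forall i, A (p i)]).

Lemma convex_setP (R : realType) (d : nat) (A : set 'rV[R]_d) :
  @convex_set R 'rV[R]_d A <->
  forall x y (t : R), 0 <= t -> t <= 1 -> A x -> A y ->
    A (t *: x + (1 - t) *: y).
Proof.
split=> [cA x y t t0 t1 Ax Ay|cA x y l]; last first.
  by rewrite !inE => Ax Ay; exact: cA.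
by have := cA x y (Itv01 t0 t1); rewrite !inE; apply.
Qed.

Lemma continuous_sum (R : realType) (T : topologicalType) (n : nat)
    (V : normedModType R) (f : 'I_n -> T -> V) :
  (forall i, continuous (f i)) -> continuous (fun x => \sum_(i < n) f i x).
Proof.
move=> cf.
have cadd : continuous (fun xy : V * V => xy.1 + xy.2) by exact: add_continuous.
exact: (continuous_big (P := xpredT) cadd (fun i _ => cf i)).
Qed.

Lemma simplex_compact (R : realType) (n : nat) : compact (simplex R n).
Proof.
have box : compact [set a : 'rV[R]_n | forall i, `[0, 1]%classic (a ord0 i)].
  have := @rV_compact R n (fun=> `[0, 1]%classic); apply => i.
  exact: segment_compact.
rewrite (_ : simplex R n =
    [set a : 'rV[R]_n | forall i, `[0, 1]%classic (a ord0 i)] `&`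
    (fun a : 'rV[R]_n => \sum_(i < n) a ord0 i) @^-1` [set 1]).
  apply: compact_closedI => //; apply: preimage_closed; last exact: closed_eq.
  by move=> a _; apply: continuous_sum => i; exact: coord_continuous.
apply/seteqP; split=> a [a01 sa]; split=> // i; last first.
  by have := a01 i; rewrite /= in_itv /= => /andP[].
rewrite /= in_itv /= a01 /= -sa (bigD1 i) //= lerDl.
by apply: sumr_ge0 => j _; exact: a01.
Qed.

(** The combination map is jointly continuous in the coefficients and the
    points, for the product topology on families of points; the families with
    values in [A] form a compact set by Tychonoff's theorem. *)
Lemma combinations_compact (R : realType) (d n : nat) (A : set 'rV[R]_d) :
  compact A -> compact (combinations n A).
Proof.
move=> cA.
pose P : set (prod_topology (fun _ : 'I_n => 'rV[R]_d)) :=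
  [set p | forall i, A (p i)].
have cP : compact P := @tychonoff _ (fun=> 'rV[R]_d) (fun=> A) (fun=> cA).
apply: (@continuous_compact ('rV[R]_n *
    prod_topology (fun _ : 'I_n => 'rV[R]_d))%type _ (@combination R d n)
    (simplex R n `*` P)); last first.
  exact: compact_setX (@simplex_compact R n) cP.
apply: continuous_subspaceT; apply: continuous_sum => i ap; apply: cvgZ.
  apply: (@continuous_comp ('rV[R]_n *
    prod_topology (fun _ : 'I_n => 'rV[R]_d))%type 'rV[R]_n R
    fst (fun a : 'rV[R]_n => a ord0 i)).
    exact: cvg_fst.
  exact: coord_continuous.
apply: (@continuous_comp _ _ _ snd
  (fun p : prod_topology (fun _ : 'I_n => 'rV[R]_d) => p i)).
  exact: cvg_snd.
exact: proj_continuous.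
Qed.

(** Induction on [n]: unless the first coefficient is 1, the others, divided by
    their sum, form a convex combination of [n] points, and the whole is a
    two-point combination of it with the first point. *)
Lemma combinations_sub_convex (R : realType) (d n : nat)
    (A B : set 'rV[R]_d) :
  @convex_set R 'rV[R]_d B -> A `<=` B -> combinations n A `<=` B.
Proof.
move=> /convex_setP cB AB _ [[a p] [[/= a0 a1] pA] <-]; rewrite /combination /=.
elim: n a p a0 a1 pA => [|n IH] a p a0 a1 pA.
  by move: a1; rewrite big_ord0 => /esym/eqP; rewrite oner_eq0.
move: a1; rewrite !big_ord_recl; set t := a ord0 ord0.
set s := \sum_(i < n) a ord0 (lift ord0 i) => ts.
have s0 : 0 <= s by apply: sumr_ge0.
have sE : s = 1 - t by rewrite -ts addrC addKr.
have t1 : t <= 1 by rewrite -subr_ge0 -sE.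
have [s_eq0|s_neq0] := eqVneq s 0.
  rewrite big1 ?addr0.
    by move: ts; rewrite s_eq0 addr0 => ->; rewrite scale1r; apply: AB.
  by move=> i _; move/psumr_eq0P: s_eq0 => -> //; rewrite scale0r.
pose b : 'rV[R]_n := \row_i (a ord0 (lift ord0 i) / s).
rewrite (_ : \sum_(i < n) _ = (1 - t) *:
    \sum_(i < n) b ord0 i *: p (lift ord0 i)).
  apply: cB => //; [exact: a0|exact/AB/pA|].
  apply: IH => //.
    by move=> i; rewrite mxE divr_ge0.
  under eq_bigr do rewrite mxE.
  by rewrite -mulr_suml divff.
rewrite scaler_sumr; apply: eq_bigr => i _.
by rewrite mxE scalerA -sE mulrCA divff // mulr1.
Qed.

Lemma combinations_convex (R : realType) (d : nat) (A : set 'rV[R]_d) :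
  @convex_set R 'rV[R]_d (\bigcup_n combinations n A).
Proof.
apply/convex_setP => x y t t0 t1 [m _ [[a p] [[/= a0 a1] /= pA] <-]].
move=> [n _ [[b q] [[/= b0 b1] /= qA] <-]]; exists (m + n)%N => //.
exists (row_mx (t *: a) ((1 - t) *: b),
  fun i : 'I_(m + n) =>
    match fintype.split i with inl j => p j | inr j => q j end) => /=.
  split=> /=; last by move=> i; case: (fintype.split i).
  split=> [i|].
    by rewrite mxE; case: (fintype.split i) => j; rewrite mxE mulr_ge0 ?subr_ge0.
  rewrite big_split_ord /=.
  under eq_bigr do rewrite row_mxEl mxE.
  under [X in _ + X]eq_bigr do rewrite row_mxEr mxE.
  by rewrite -!mulr_sumr a1 b1 !mulr1 addrC subrK.
rewrite /combination /= big_split_ord /= !scaler_sumr.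
congr (_ + _); apply: eq_bigr => i _; rewrite scalerA.
  by rewrite row_mxEl mxE -[lshift n i]/(unsplit (inl i)) unsplitK.
by rewrite row_mxEr mxE -[rshift m i]/(unsplit (inr i)) unsplitK.
Qed.

Lemma combinations1 (R : realType) (d : nat) (A : set 'rV[R]_d) :
  A `<=` combinations 1 A.
Proof.
move=> x Ax; exists (1, fun=> x); last first.
  by rewrite /combination big_ord1 /= mxE eqxx scale1r.
split=> //=; split=> [i|]; last by rewrite big_ord1 mxE.
by rewrite !mxE ler0n.
Qed.

Lemma combinationsS (R : realType) (d n : nat) (A : set 'rV[R]_d) :
  combinations n A `<=` combinations n.+1 A.
Proof.
move=> _ [[a p] [[/= a0 a1] /= pA] <-].
case: n a p a0 a1 pA => [|n] a p a0 a1 pA.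
  by move: a1; rewrite big_ord0 => /esym/eqP; rewrite oner_eq0.
exists (\row_i (if unlift ord0 i is Some j then a ord0 j else 0),
  fun i => p (odflt ord0 (unlift ord0 i))); last first.
  rewrite /combination /= big_ord_recl mxE unlift_none scale0r add0r.
  by apply: eq_bigr => i _; rewrite mxE liftK.
split=> //=; split=> [i|]; first by rewrite mxE; case: unlift.
rewrite big_ord_recl mxE unlift_none add0r -a1.
by apply: eq_bigr => i _; rewrite mxE liftK.
Qed.

(** The [n] vectors [(1, p_i)] live in dimension [d + 1 < n], so they are
    linearly dependent; the coordinate 1 forces the coefficients of a relation
    to have sum zero, hence one of them is positive. *)
Lemma affine_dependence (R : realType) (d n : nat) (p : 'I_n -> 'rV[R]_d) :
  (d.+1 < n)%N ->
  exists v : 'rV[R]_n, [/\ exists i, 0 < v ord0 i,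
    \sum_(i < n) v ord0 i = 0 & \sum_(i < n) v ord0 i *: p i = 0].
Proof.
move=> dn.
pose M : 'M[R]_(n, 1 + d) := \matrix_i row_mx 1 (p i).
have : kermx M != 0.
  by rewrite kermx_eq0 /row_free neq_ltn (leq_ltn_trans (rank_leq_col M)).
case/rowV0Pn => v /sub_kermxP vM v0; exists v.
have vME : v *m M = \sum_(i < n) v ord0 i *: row_mx 1 (p i).
  by rewrite mulmx_sum_row; apply: eq_bigr => i _; rewrite rowK.
have sum0 : \sum_(i < n) v ord0 i = 0.
  move/(congr1 (fun w => lsubmx w ord0 ord0)): vM.
  rewrite vME raddf_sum /= summxE [RHS]mxE [RHS]mxE => sum0; rewrite -[RHS]sum0.
  by apply: eq_bigr => i _; rewrite scale_row_mx row_mxKl !mxE mulr1.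
split=> //.
  apply: contrapT => vneg; case/eqP: v0; apply/rowP => i.
  have vle j : 0 <= - v ord0 j.
    by rewrite oppr_ge0 leNgt; apply/negP => vj; apply: vneg; exists j.
  have /psumr_eq0P : \sum_(i < n) - v ord0 i = 0 by rewrite sumrN sum0 oppr0.
  by rewrite mxE => /(_ (fun j _ => vle j) i isT)/eqP; rewrite oppr_eq0 => /eqP.
move/(congr1 rsubmx): vM; rewrite vME raddf_sum raddf0 => vp0.
rewrite -[RHS]vp0.
by apply: eq_bigr => i _; rewrite /= scale_row_mx row_mxKr.
Qed.

(** Subtracting from the coefficients the largest multiple of an affine
    dependence that keeps them all nonnegative makes one of them vanish, while
    their sum and the combined point do not change. *)
Lemma caratheodory_step (R : realType) (d n : nat) (A : set 'rV[R]_d) :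
  (d.+1 <= n)%N -> combinations n.+1 A `<=` combinations n A.
Proof.
move=> dn _ [[a p] [[/= a0 a1] /= pA] <-].
have [v [[i0 vi0] v0 vp0]] := affine_dependence p dn.
have [i vi imin] :=
  @arg_minP _ _ _ i0 (fun i => 0 < v ord0 i) (fun i => a ord0 i / v ord0 i) vi0.
pose t := a ord0 i / v ord0 i.
pose b j := a ord0 j - t * v ord0 j.
have t0 : 0 <= t by rewrite divr_ge0 // ltW.
have bi : b i = 0 by rewrite /b /t divfK ?subrr // gt_eqF.
have b0 j : 0 <= b j.
  rewrite subr_ge0; have [vj|vj] := ltP 0 (v ord0 j).
    by rewrite -ler_pdivlMr //; exact: imin.
  exact: le_trans (mulr_ge0_le0 t0 vj) (a0 j).
have b1 : \sum_(j < n.+1) b j = 1.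
  by rewrite sumrB -mulr_sumr v0 mulr0 subr0.
have bp : \sum_(j < n.+1) b j *: p j = combination (a, p).
  under eq_bigr do rewrite scalerBl -scalerA.
  by rewrite sumrB -scaler_sumr vp0 scaler0 subr0.
exists (\row_j b (lift i j), p \o lift i) => /=.
  split=> //=; split=> [j|]; first by rewrite mxE.
  under eq_bigr do rewrite mxE.
  by rewrite -b1 [RHS](bigD1_ord i) //= bi add0r.
rewrite -bp [RHS](bigD1_ord i) //= bi scale0r add0r /combination /=.
by apply: eq_bigr => j _; rewrite mxE.
Qed.

Lemma combinations_le (R : realType) (d m n : nat) (A : set 'rV[R]_d) :
  (m <= n)%N -> combinations m A `<=` combinations n A.
Proof.
move=> /subnK <-; elim: (n - m)%N => // k IH.
by apply: subset_trans IH _; exact: combinationsS.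
Qed.

Lemma caratheodory (R : realType) (d : nat) (A : set 'rV[R]_d) :
  convex_hull A = combinations d.+1 A.
Proof.
apply/seteqP; split; last first.
  by move=> x Ax B [cB AB]; exact: combinations_sub_convex cB AB _ Ax.
apply: subset_trans (_ : \bigcup_n combinations n A `<=` _).
  apply: smallest_sub; first exact: combinations_convex.
  by move=> x Ax; exists 1%N => //; exact: combinations1.
move=> x [n _]; have [nd|/ltnW dn] := leqP n d.+1; first exact: combinations_le.
rewrite -(subnK dn); elim: (n - d.+1)%N => // k IH xk.
by apply/IH/(@caratheodory_step _ _ (k + d.+1)) => //; exact: leq_addl.
Qed.

Lemma convex_hull_compact (R : realType) (d : nat) (A : set 'rV[R]_d) :
  compact A -> compact (convex_hull A).
Proof. by rewrite caratheodory; exact: combinations_compact. Qed.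

(** * Affine maps and convex sets *)

Lemma affine_map_continuous (R : realType) (d : nat)
    (f : 'rV[R]_d -> 'rV[R]_d) : affine_map f -> continuous f.
Proof.
case=> L [b fE].
have -> : f = fun x => (\sum_(i < d) x ord0 i *: L 'e_i) + b.
  apply/funext => x; rewrite fE {1}[x]row_sum_delta linear_sum /=.
  by congr (_ + _); apply: eq_bigr => i _; rewrite linearZ.
move=> x; apply: (@continuousD _ _ _ (fun x : 'rV[R]_d =>
    \sum_(i < d) x ord0 i *: L 'e_i) (cst b)); last exact: cst_continuous.
apply: continuous_sum => i y.
apply: (@continuousZ _ _ _ (fun y : 'rV[R]_d => y ord0 i) (cst (L 'e_i))).
  exact: coord_continuous.
exact: cst_continuous.
Qed.

Lemma affine_map_inverse (R : realType) (d : nat)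
    (f g : 'rV[R]_d -> 'rV[R]_d) :
  affine_map f -> cancel f g -> cancel g f -> affine_map g.
Proof.
case=> L [b fE] fK gK.
pose M x := g (x + b).
have LK : cancel L M by move=> x; rewrite /M -fE fK.
have MK : cancel M L by move=> x; apply: (addIr b); rewrite -fE gK.
pose linM := GRing.isLinear.Build _ _ _ _ M (can2_linear LK MK).
pose ML : {linear 'rV[R]_d -> 'rV[R]_d} := HB.pack M linM.
exists ML, (g 0) => x.
apply: (can_inj fK); rewrite gK.
have := gK 0; rewrite !fE linearD /= => Lg0.
by rewrite -addrA Lg0 addr0 MK.
Qed.

Lemma affine_bij_open (R : realType) (d : nat) (f : 'rV[R]_d -> 'rV[R]_d)
    (A : set 'rV[R]_d) :
  affine_map f -> bijective f -> open A -> open (f @` A).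
Proof.
move=> af [g fK gK] oA.
rewrite (_ : f @` A = g @^-1` A).
  apply: open_comp => // x _; apply: affine_map_continuous.
  exact: affine_map_inverse af fK gK.
apply/seteqP; split=> [_ [x Ax <-]|x Agx]; first by rewrite /= fK.
by exists (g x); rewrite ?gK.
Qed.

Lemma convex_hull_convex (R : realType) (d : nat) (A : set 'rV[R]_d) :
  @convex_set R 'rV[R]_d (convex_hull A).
Proof.
apply/convex_setP => x y t t0 t1 Ax Ay B [cB AB].
by move/convex_setP: (cB); apply => //; [apply: Ax|apply: Ay].
Qed.

(** The preimage of a convex set by an affine map is convex, so the preimage of
    the hull contains the hull as soon as it contains [A]. *)
Lemma affine_map_convex_hull (R : realType) (d : nat)
    (f : 'rV[R]_d -> 'rV[R]_d) (A : set 'rV[R]_d) :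
  affine_map f -> f @` A `<=` convex_hull A ->
  f @` convex_hull A `<=` convex_hull A.
Proof.
move=> [L [b fE]] fA _ [x Ax <-].
apply: (Ax (f @^-1` convex_hull A)); split; last first.
  by move=> y Ay; apply: fA; exists y.
apply/convex_setP => y z t t0 t1 Ay Az /=.
rewrite (_ : f _ = t *: f y + (1 - t) *: f z).
  by move/convex_setP: (@convex_hull_convex R d A); apply.
rewrite !fE linearD !linearZ /= !scalerDr addrACA -scalerDl.
by rewrite [t + _]addrC subrK scale1r.
Qed.

(** A point [x] of [C] is the limit, for [t] tending to 0 from above, of the
    images of an interior point [c] by the homothety of centre [x] and ratio
    [t]; for [0 < t <= 1] this homothety maps [C] into [C] and interior points
    of [C] to interior points of [C]. *)
Lemma convex_closure_interior (R : realType) (d : nat) (C : set 'rV[R]_d) :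
  @convex_set R 'rV[R]_d C -> interior C !=set0 -> C `<=` closure (interior C).
Proof.
move=> /convex_setP cC [c ic] x Cx N Nx.
pose h (t : R) : 'rV[R]_d := t *: (c - x) + x.
have h0 : h 0 = x by rewrite /h scale0r add0r.
have ch : continuous h.
  move=> t; apply: (@continuousD _ _ _ (fun t : R => t *: (c - x)) (cst x)).
    apply: (@continuousZ _ _ _ id (cst (c - x))); first exact: cvg_id.
    exact: cst_continuous.
  exact: cst_continuous.
have hN : \forall t \near 0^'+, N (h t).
  have hcvg : h z @[z --> 0^'+] --> h 0.
    by apply: cvg_at_right_filter; exact: ch.
  by apply: (hcvg N); rewrite h0.
have [t [t0 [t1 Nt]]] : exists t, 0 < t /\ t < 1 /\ N (h t).
  have : \forall t \near (0:R)^'+, 0 < t /\ t < 1 /\ N (h t).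
    near=> t; split; first by [].
    by split; [near: t; exact: nbhs_right_lt|near: t].
  by move/filter_ex.
exists (h t); split=> //.
(* The inverse homothety: the preimage of the interior by it is an open set
   containing [h t], and it is contained in [C] by convexity. *)
pose g (y : 'rV[R]_d) := t^-1 *: (y - x) + x.
have gh : g (h t) = c.
  by rewrite /g /h addrK scalerA mulVf ?scale1r ?subrK // gt_eqF.
have cg : continuous g.
  move=> y; apply: (@continuousD _ _ _
    (fun y : 'rV[R]_d => t^-1 *: (y - x)) (cst x)).
    apply: (@continuousZ _ _ _ (cst t^-1) (fun y : 'rV[R]_d => y - x)).
      exact: cst_continuous.
    apply: (@continuousB _ _ _ id (cst x)); first exact: cvg_id.
    exact: cst_continuous.
  exact: cst_continuous.
suff : g @^-1` interior C `<=` C.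
  move/interiorS; apply; rewrite -[interior _]/(_^°)%classic.
  have /interior_id -> : open (g @^-1` interior C).
    by apply: open_comp; [move=> y _; exact: cg|exact: open_interior].
  by rewrite /= gh.
move=> y /interior_subset Cgy.
have -> : y = t *: g y + (1 - t) *: x.
  rewrite /g scalerDr scalerA divff ?gt_eqF // scale1r -addrA -scalerDl.
  by rewrite [t + _]addrC subrK scale1r subrK.
by apply: cC => //; exact: ltW.
Unshelve. all: by end_near. Qed.

Lemma setD_sub_closure_interior (T : topologicalType) (C D : set T) :
  C `<=` closure (interior C) -> closed D ->
  C `\` D `<=` closure (interior (C `\` D)).
Proof.
move=> regC cD x [Cx nDx] N Nx.
have nDN : nbhs x (N `&` ~` D).
  apply: filterI => //; apply: open_nbhs_nbhs; split=> //; exact: closed_openC.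
have [y [iCy [Ny nDy]]] := regC x Cx _ nDN; exists y; split=> //.
apply: filterI => //; apply: open_nbhs_nbhs; split=> //; exact: closed_openC.
Qed.

(** * Iterates of the set map *)

Lemma ifs_mapS (R : realType) (d J : nat) (Phi : 'I_J -> 'rV[R]_d -> 'rV[R]_d)
    (A B : set 'rV[R]_d) :
  A `<=` B -> ifs_map Phi A `<=` ifs_map Phi B.
Proof.
by move=> AB _ [j _ [x Ax <-]]; exists j => //; exists x => //; apply: AB.
Qed.

Lemma ifs_map_closed (R : realType) (d J : nat)
    (Phi : 'I_J -> 'rV[R]_d -> 'rV[R]_d) (A : set 'rV[R]_d) :
  (forall j, continuous (Phi j)) -> compact A -> closed (ifs_map Phi A).
Proof.
move=> cPhi cA; apply: closed_bigcup; first exact: finite_finset.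
move=> j _; apply: compact_closed; first exact: norm_hausdorff.
apply: continuous_compact => //; apply: continuous_subspaceT; exact: cPhi.
Qed.

Lemma ifs_iterS (R : realType) (d J : nat) (Phi : 'I_J -> 'rV[R]_d -> 'rV[R]_d)
    (k : nat) (A B : set 'rV[R]_d) :
  A `<=` B -> ifs_iter Phi k A `<=` ifs_iter Phi k B.
Proof. by elim: k => //= k IH AB; exact/ifs_mapS/IH. Qed.

Lemma ifs_iter_stable (R : realType) (d J : nat)
    (Phi : 'I_J -> 'rV[R]_d -> 'rV[R]_d) (k : nat) (A D : set 'rV[R]_d) :
  ifs_map Phi D `<=` D -> A `<=` D -> ifs_iter Phi k A `<=` D.
Proof.
move=> PD AD; elim: k => //= k IH.
exact: subset_trans (ifs_mapS IH) PD.
Qed.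

Lemma ifs_iter_bigcup (R : realType) (d J : nat)
    (Phi : 'I_J -> 'rV[R]_d -> 'rV[R]_d) (k : nat) (I : Type) (P : set I)
    (A : I -> set 'rV[R]_d) :
  \bigcup_(i in P) ifs_iter Phi k (A i) =
  ifs_iter Phi k (\bigcup_(i in P) A i).
Proof.
elim: k => //= k IH; rewrite -IH; apply/seteqP; split.
  by move=> _ [i Pi [j _ [x Ax <-]]]; exists j => //; exists x => //; exists i.
by move=> _ [j _ [x [i Pi Ax] <-]]; exists i => //; exists j => //; exists x.
Qed.

Lemma ifs_iter_setD (R : realType) (d J : nat)
    (Phi : 'I_J -> 'rV[R]_d -> 'rV[R]_d) (k : nat) (A B : set 'rV[R]_d) :
  ifs_iter Phi k A `\` ifs_iter Phi k B `<=` ifs_iter Phi k (A `\` B).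
Proof.
elim: k => //= k IH _ [[j _ [x Ax <-]] nB].
exists j => //; exists x => //; apply: IH; split=> // Bx.
by apply: nB; exists j => //; exists x.
Qed.

Lemma ifs_iter_closure (R : realType) (d J : nat)
    (Phi : 'I_J -> 'rV[R]_d -> 'rV[R]_d) (k : nat) (A : set 'rV[R]_d) :
  (forall j, continuous (Phi j)) ->
  ifs_iter Phi k (closure A) `<=` closure (ifs_iter Phi k A).
Proof.
move=> cPhi; elim: k => //= k IH _ [j _ [x /IH clx <-]] N Nx.
have [y [Ay Ny]] := clx _ (cPhi j x _ Nx).
by exists (Phi j y); split=> //; exists j => //; exists y.
Qed.

(** The interior of [Phi_j C] is a neighbourhood of [Phi_j x = Phi_l y]; as [y]
    is a limit of interior points of [C], it contains some [Phi_l w] with [w]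
    interior to [C]. For [j <> l] this would be a common interior point of two
    tiles. *)
Lemma tile_address (R : realType) (d J : nat)
    (Phi : 'I_J -> 'rV[R]_d -> 'rV[R]_d) (C : set 'rV[R]_d) :
  (forall j, continuous (Phi j)) ->
  (forall j A, open A -> open (Phi j @` A)) ->
  tileset_condition Phi C -> C `<=` closure (interior C) ->
  forall j l x y, interior C x -> C y -> Phi j x = Phi l y -> j = l.
Proof.
move=> cPhi oPhi tC regC j l x y iCx Cy xy.
have iPhi i z : interior C z -> interior (Phi i @` C) (Phi i z).
  move=> iCz; have PiS : Phi i @` interior C `<=` interior (Phi i @` C).
    rewrite -open_subsetE; last exact/oPhi/open_interior.
    by apply: image_subset; exact: interior_subset.
  by apply: PiS; exists z.
have [w [iCw jw]] : interior C `&` Phi l @^-1` interior (Phi j @` C) !=set0.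
  apply: regC Cy _ _; apply: cPhi; rewrite -xy.
  exact: open_nbhs_nbhs (conj (@open_interior _ _) (iPhi j x iCx)).
apply/eqP; apply: contraPT jw => jl jw.
suff : set0 (Phi l w) by [].
by rewrite -(tC j l jl); split => //; exact: iPhi.
Qed.

(** A common point is both [Phi_j x] and [Phi_l y], with [x] in the previous
    iterate of [A], still inside the interior of [C], and [y] in that of [B],
    still inside [C]; then [j = l], so [x = y] by injectivity, against the
    induction hypothesis. *)
Lemma ifs_iter_disjoint (R : realType) (d J : nat)
    (Phi : 'I_J -> 'rV[R]_d -> 'rV[R]_d) (C A B : set 'rV[R]_d) (k : nat) :
  (forall j, continuous (Phi j)) -> (forall j, injective (Phi j)) ->
  (forall j A, open A -> open (Phi j @` A)) ->
  tileset_condition Phi C -> C `<=` closure (interior C) ->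
  ifs_map Phi C `<=` C -> A `<=` interior C -> B `<=` C ->
  A `&` B = set0 -> ifs_iter Phi k A `&` ifs_iter Phi k B = set0.
Proof.
move=> cPhi iPhi oPhi tC regC PC AC BC AB.
have PiC : ifs_map Phi (interior C) `<=` interior C.
  rewrite -open_subsetE; last first.
    by apply: bigcup_open => j _; exact/oPhi/open_interior.
  by apply: subset_trans PC; apply: ifs_mapS; exact: interior_subset.
elim: k => //= k IH; rewrite -subset0 => z [[j _ [x Ax <-]] [l _ [y By yx]]].
have iCx := ifs_iter_stable PiC AC Ax.
have Cy := ifs_iter_stable PC BC By.
have jl := tile_address cPhi oPhi tC regC iCx Cy (esym yx).
move: yx; rewrite -jl => /iPhi yx; move: By; rewrite yx => By.
by suff : set0 x by []; rewrite -IH; split.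
Qed.

(** * Tilesets and generators *)

Theorem theorem5p15 (R : realType) (d J : nat)
    (Phi : 'I_J -> 'rV[R]_d -> 'rV[R]_d) (F : set 'rV[R]_d)
    (hPhi : self_affine_system Phi)
    (hF : is_attractor Phi F)
    (hdim : full_dim (convex_hull F))
    (htile : tileset_condition Phi (convex_hull F))
    (hnontriv : nontriviality_condition Phi (convex_hull F))
    (k : nat) (hk : (1 <= k)%N) :
  trivIset (generators Phi (convex_hull F)) (ifs_iter Phi k.-1) /\
  tileset Phi (convex_hull F) k =
    closure (\bigcup_(G in generators Phi (convex_hull F))
               ifs_iter Phi k.-1 G).
Proof.
set C := convex_hull F in htile hnontriv *.
have [_ affPhi] := hPhi; have [_ cptF FE] := hF.
have cPhi j : continuous (Phi j).
  by have [aj _ _] := affPhi j; exact: affine_map_continuous.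
have iPhi j : injective (Phi j) by have [_ /bij_inj] := affPhi j.
have oPhi j A : open A -> open (Phi j @` A).
  by have [aj bj _] := affPhi j; exact: affine_bij_open.
have PC : ifs_map Phi C `<=` C.
  apply: bigcup_sub => j _; have [aj _ _] := affPhi j.
  apply: affine_map_convex_hull => //.
  apply: subset_trans (@sub_smallest _ _ F F _) => //.
  by rewrite {2}FE => x Fx; exists j.
(* An empty interior would be contained in the image of [C]. *)
have regC : C `<=` closure (interior C).
  apply: convex_closure_interior; first exact: convex_hull_convex.
  by apply/set0P/eqP => C0; apply: hnontriv; rewrite C0; exact: sub0set.
have disj A B n : A `<=` interior C -> B `<=` C -> A `&` B = set0 ->
    ifs_iter Phi n A `&` ifs_iter Phi n B = set0.
  exact: ifs_iter_disjoint.
case: k hk => // k _ /=.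
set U := interior (C `\` ifs_map Phi C).
have UC : U `<=` interior C by apply: interiorS; exact: subDsetl.
split.
  move=> _ _ [x Ux <-] [y Uy <-] [z [Gz Hz]].
  apply: contrapT => GH.
  suff : ifs_iter Phi k (connected_component U x) `&`
         ifs_iter Phi k (connected_component U y) = set0.
    by move=> E; suff : set0 z by []; rewrite -E.
  apply: disj.
  - by apply: subset_trans UC; exact: connected_component_sub.
  - apply: subset_trans (@interior_subset _ C); apply: subset_trans UC.
    exact: connected_component_sub.
  rewrite -subset0 => w [xw yw]; apply: GH.
  by rewrite (same_connected_component xw) (same_connected_component yw).
rewrite ifs_iter_bigcup connected_component_cover /tileset /=.
rewrite [ifs_map Phi _](iterSr k (ifs_map Phi) C).
apply/seteqP; split.
  apply: subset_trans (closureS (subset_trans (@ifs_iter_setD _ _ _ Phi k _ _)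
    (@ifs_iterS _ _ _ _ k _ _ _))) _.
    apply: setD_sub_closure_interior => //.
    exact/ifs_map_closed/convex_hull_compact.
  have clid := iffLR (closure_id _) (@closed_closure _ (ifs_iter Phi k U)).
  by rewrite [X in _ `<=` X]clid; apply: closureS; exact: ifs_iter_closure.
apply: closureS => x Ux; split.
  by move: Ux; apply: ifs_iterS => y /UC/interior_subset.
move=> Px; suff : set0 x by [].
rewrite -(disj U (ifs_map Phi C) k UC PC); first by split.
by rewrite -subset0 => y [/interior_subset[]].
Qed.
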